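(* In the case of one moving load, the eigenvalues and the natural frequencies of the dynamical system described in the context (a cable along which a single discrete load of mass $m_1$ moves at a steady speed $v$) decrease with the controlled parameter $v$, i.e. they decrease when the velocity $v$ increases.
   Context: A cable of length $l$ has mass per unit length $\rho$ and tension $T$; put $a=\sqrt{T/\rho}$. One discrete load of mass $m_1$ moves along the cable at steady speed $v$ (the controlled parameter), so that at time $t\in[t_0,t_1]$ it is at the point $x=l_1(t)=l_1+vt$. Let $u_1(x,t)$ for $x\in[0,l_1(t)]$ and $u_2(x,t)$ for $x\in[l_1(t),l]$ be the deviations from the equilibrium position. The dynamical system is the non-stationary boundary problem $$\rho\,\frac{\partial^2u_i}{\partial t^2}=T\,\frac{\partial^2u_i}{\partial x^2}\quad(i=1,2),\qquad u_1(0,t)=u_2(l,t)=0,$$ with the conjugation conditions at $x=l_1(t)$: $u_2=u_1$ and $$m_1\Big(\frac{\partial^2u_1}{\partial t^2}+2v\frac{\partial^2u_1}{\partial x\,\partial t}+v^2\frac{\partial^2u_1}{\partial x^2}\Big)=T\Big(\frac{\partial u_2}{\partial x}-\frac{\partial u_1}{\partial x}\Big).$$ The (non-stationary) eigenvalues $\lambda=\lambda(t)$, $t_0\le t\le t_1$, are the zeros of the left-hand side of the equation $$\frac{\sin(\lambda l)}{\lambda}-\frac{m_1}{\rho}(a^2+v^2)\sin(\lambda b_1)\sin(\lambda b_2)=0,$$ where, at a fixed moment of time, $b_1$ is the coordinate of the load (its distance from the end $x=0$) and $b_2=l-b_1$. The natural frequencies at each fixed moment of time are $\omega_k=a\lambda_k$,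 $k=1,2,\ldots$
   Formalization: With the load's coordinate b_1 held fixed, each eigenvalue and natural frequency is shown to be non-increasing in v, and strictly decreasing except when the load sits at a node of the mode (sin(λb_1)=sin(λb_2)=0), where it does not depend on v. *)

(* Defs.v *)
From Stdlib Require Import Reals.
Local Open Scope R_scope.

Definition wave_speed (rho T : R) : R := sqrt (T / rho).

(* [b1] is the coordinate of the load at the fixed moment of time considered,
   so that the whole time dependence of the eigenvalues goes through [b1];
   [v] is the speed of the load at that moment. *)
Definition char_lhs (l rho T m1 b1 v lambda : R) : R :=
  let a := wave_speed rho T in
  let b2 := l - b1 in
  sin (lambda * l) / lambda
    - m1 / rho * (a ^ 2 + v ^ 2) * sin (lambda * b1) * sin (lambda * b2).

(* The left-hand side is even in [lambda] and tends to [l <> 0] at [0], so [0]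
   is not an eigenvalue; positivity is required explicitly because division is
   total and [char_lhs] takes the junk value [0] at [lambda = 0]. *)
Definition is_eigenvalue (l rho T m1 b1 v lambda : R) : Prop :=
  0 < lambda /\ char_lhs l rho T m1 b1 v lambda = 0.

(* [lam 1 < lam 2 < ...] lists all the eigenvalues; [lam 0] is irrelevant.
   There is at most one such list up to [lam 0].  All the zeros of [char_lhs]
   on the positive half-line are simple, so that counting them with
   multiplicities would give the same list. *)
Definition eigenvalue_sequence (l rho T m1 b1 v : R) (lam : nat -> R) : Prop :=
  (forall j k : nat, (1 <= j)%nat -> (j < k)%nat -> lam j < lam k) /\
  (forall lambda : R,
     is_eigenvalue l rho T m1 b1 v lambda <->
     exists k : nat, (1 <= k)%nat /\ lambda = lam k).

Definition natural_frequency (rho T : R) (lam : nat -> R) (k : nat) : R :=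
  wave_speed rho T * lam k.

(* The mode [sin (lambda x)] has a node at the load.  Such a [lambda] solves the
   characteristic equation for every [v] as soon as it does for one [v] : the
   term containing [v] vanishes there.  It is the only obstruction to strict
   monotonicity in [v]. *)
Definition load_at_node (l b1 lambda : R) : Prop :=
  sin (lambda * b1) = 0 /\ sin (lambda * (l - b1)) = 0.

(* Main.v *)
Require Import Defs.
From Stdlib Require Import Reals Lra Lia ZArith Wf_nat.
From Coquelicot Require Import Coquelicot.
Local Open Scope R_scope.

(** Shoot the mode from the end [x = 0].  Up to the load the solution is
    [u = sin (lambda x)], so the Prufer angle of the vector [(u, u' / lambda)]
    is [lambda x] and reaches [alpha = lambda b1].  The load makes the slope
    jump: [(sin alpha, cos alpha)] becomes
    [(sin alpha, cos alpha - s sin alpha)] with [s = M lambda] and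
    [M = m1 / rho (a^2 + v^2)].  This shear advances the angle by some
    [phase_kick alpha s] in [[0, PI)].  On the remaining length the angle grows
    by [lambda (l - b1)].  The final angle [end_phase l b1 M lambda] satisfies
<<
      r sin (end_phase) = sin (lambda l)
                            - M lambda sin (lambda b1) sin (lambda (l - b1))
>>
    with [r > 0] (lemma [end_phase_char]), so [lambda > 0] is an eigenvalue iff
    the final angle is a multiple of [PI].

    For fixed [M] the final angle is continuous, strictly increasing and
    unbounded in [lambda], and vanishes at [0].  Hence the [k]-th eigenvalue is
    exactly the point where it equals [k PI]; this gives both the existence of
    the list and a characterisation of its [k]-th entry.  A larger [v] means a
    larger [M], hence a larger final angle at every [lambda], so the level
    [k PI] is reached no later; and it is reached strictly earlier unless
    [sin (lambda b1) = 0] at the eigenvalue, that is, unless the load sits at a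
    node.

    Both monotonicity properties of the sheared angle come from one identity.
    The cross product of two sheared vectors ([kicked_angle_cross]) is explicit,
    and since the kicks lie in [[0, PI)] the sign of the sine of the difference
    of two angles decides the sign of the difference itself. *)

(** * The angle of the sheared vector *)

Definition kicked_radius (alpha s : R) : R :=
  sqrt (sin alpha ^ 2 + (cos alpha - s * sin alpha) ^ 2).

(** Half-angle form of the argument of
    [(1 - s sin alpha cos alpha, s sin alpha ^ 2)], the sheared vector in the
    frame turned by [alpha].  Unlike a quotient of the two coordinates, it is
    a smooth formula everywhere: its denominator never vanishes. *)
Definition phase_kick (alpha s : R) : R :=
  2 * atan (s * sin alpha ^ 2 /
            (kicked_radius alpha s + (1 - s * sin alpha * cos alpha))).

Definition kicked_angle (alpha s : R) : R := alpha + phase_kick alpha s.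

Lemma sin2_add_cos2 (x : R) : sin x ^ 2 + cos x ^ 2 = 1.
Proof. generalize (sin2_cos2 x); unfold Rsqr; lra. Qed.

Lemma kicked_vector_neq0 (alpha s : R) :
  0 < sin alpha ^ 2 + (cos alpha - s * sin alpha) ^ 2.
Proof.
  pose proof (sin2_add_cos2 alpha) as H.
  destruct (Req_dec (sin alpha) 0) as [H0|H0].
  - rewrite H0 in *. nra.
  - pose proof (pow2_gt_0 _ H0). pose proof (pow2_ge_0 (cos alpha - s * sin alpha)). lra.
Qed.

Lemma kicked_radius_gt0 (alpha s : R) : 0 < kicked_radius alpha s.
Proof. apply sqrt_lt_R0, kicked_vector_neq0. Qed.

Lemma kicked_radius_sqr (alpha s : R) :
  kicked_radius alpha s ^ 2 =
  (1 - s * sin alpha * cos alpha) ^ 2 + (s * sin alpha ^ 2) ^ 2.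
Proof.
  unfold kicked_radius.
  rewrite pow2_sqrt by (left; apply kicked_vector_neq0).
  assert (Hc : cos alpha ^ 2 = 1 - sin alpha ^ 2)
    by (pose proof (sin2_add_cos2 alpha); lra).
  replace ((1 - s * sin alpha * cos alpha) ^ 2) with
    (1 - 2 * s * sin alpha * cos alpha + s ^ 2 * sin alpha ^ 2 * cos alpha ^ 2) by ring.
  replace ((cos alpha - s * sin alpha) ^ 2) with
    (cos alpha ^ 2 - 2 * s * sin alpha * cos alpha + s ^ 2 * sin alpha ^ 2) by ring.
  rewrite Hc. ring.
Qed.

(** The denominator could vanish only for a sheared vector on the negative
    half-axis of the turned frame; but a zero second coordinate
    [s sin alpha ^ 2] forces the first one to be [1]. *)
Lemma phase_kick_denominator_gt0 (alpha s : R) :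
  0 < kicked_radius alpha s + (1 - s * sin alpha * cos alpha).
Proof.
  pose proof (kicked_radius_gt0 alpha s) as Hr.
  pose proof (kicked_radius_sqr alpha s) as H2.
  destruct (Rle_lt_dec (1 - s * sin alpha * cos alpha) 0) as [Hx|Hx]; [|lra].
  assert (Hy : s * sin alpha ^ 2 <> 0).
  { intros Hy.
    assert (H : s * sin alpha = 0).
    { apply Rsqr_0_uniq. unfold Rsqr.
      replace (s * sin alpha * (s * sin alpha)) with (s * (s * sin alpha ^ 2)) by ring.
      rewrite Hy; ring. }
    rewrite H in Hx. lra. }
  pose proof (pow2_gt_0 _ Hy). nra.
Qed.

Lemma phase_kick_bounds (alpha s : R) : 0 <= s -> 0 <= phase_kick alpha s < PI.
Proof.
  intros Hs. unfold phase_kick.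
  pose proof (phase_kick_denominator_gt0 alpha s) as Hd.
  set (t := _ / _).
  assert (Ht : 0 <= t).
  { apply Rmult_le_pos; [|left; now apply Rinv_0_lt_compat].
    apply Rmult_le_pos; [easy|apply pow2_ge_0]. }
  pose proof (atan_bound t).
  assert (0 <= atan t).
  { rewrite <- atan_0. destruct Ht as [Ht|Ht]; [|rewrite Ht; lra].
    left; now apply atan_increasing. }
  lra.
Qed.

(** The shear moves a vector by [- s sin alpha] along the axis of slopes, hence
    fixes the vectors of zero displacement. *)
Lemma phase_kick_node (alpha s : R) : sin alpha = 0 -> phase_kick alpha s = 0.
Proof.
  intros H. unfold phase_kick. rewrite H. unfold Rdiv.
  rewrite pow_i, Rmult_0_r, Rmult_0_l, atan_0 by lia. ring.
Qed.

(** With [(x, y)] the sheared vector in the turned frame and [r] its length,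
    [t = y / (r + x)] is the tangent of half its argument, so [2 atan t] has
    sine [y / r] and cosine [x / r]; turning back by [alpha] gives the claim. *)
Lemma kicked_angle_polar (alpha s : R) :
  kicked_radius alpha s * sin (kicked_angle alpha s) = sin alpha /\
  kicked_radius alpha s * cos (kicked_angle alpha s) = cos alpha - s * sin alpha.
Proof.
  pose proof (kicked_radius_gt0 alpha s) as Hr.
  pose proof (kicked_radius_sqr alpha s) as H2.
  pose proof (phase_kick_denominator_gt0 alpha s) as Hd.
  unfold kicked_angle, phase_kick.
  set (r := kicked_radius alpha s) in *.
  set (x := 1 - s * sin alpha * cos alpha) in *.
  set (y := s * sin alpha ^ 2) in *.
  set (t := y / (r + x)).
  assert (Ht : 1 + t ^ 2 = 2 * r / (r + x)).
  { unfold t. apply (Rmult_eq_reg_r ((r + x) ^ 2)); [|nra].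
    replace ((1 + (y / (r + x)) ^ 2) * (r + x) ^ 2) with ((r + x) ^ 2 + y ^ 2)
      by (field; lra).
    replace (2 * r / (r + x) * (r + x) ^ 2) with (2 * r * (r + x)) by (field; lra).
    nra. }
  assert (Hc2 : cos (atan t) ^ 2 = (r + x) / (2 * r)).
  { rewrite cos_atan.
    replace ((1 / sqrt (1 + t²)) ^ 2) with (/ (sqrt (1 + t²)) ^ 2)
      by (field; apply Rgt_not_eq, sqrt_lt_R0; unfold Rsqr; nra).
    rewrite pow2_sqrt by (unfold Rsqr; nra).
    replace (1 + t²) with (1 + t ^ 2) by (unfold Rsqr; ring).
    rewrite Ht. field; lra. }
  assert (Hs : sin (atan t) = t * cos (atan t)).
  { rewrite sin_atan, cos_atan. unfold Rdiv; ring. }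
  assert (Hsin : r * sin (2 * atan t) = y).
  { rewrite sin_2a, Hs.
    replace (r * (2 * (t * cos (atan t)) * cos (atan t)))
      with (2 * r * t * cos (atan t) ^ 2) by ring.
    rewrite Hc2. unfold t. field; lra. }
  assert (Hcos : r * cos (2 * atan t) = x).
  { rewrite cos_2a_cos.
    replace (r * (2 * cos (atan t) * cos (atan t) - 1))
      with (2 * r * cos (atan t) ^ 2 - r) by ring.
    rewrite Hc2. field; lra. }
  pose proof (sin2_add_cos2 alpha) as Hp.
  split.
  - rewrite sin_plus.
    replace (r * (sin alpha * cos (2 * atan t) + cos alpha * sin (2 * atan t)))
      with (sin alpha * (r * cos (2 * atan t)) + cos alpha * (r * sin (2 * atan t))) by ring.
    rewrite Hsin, Hcos. unfold x, y. ring.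
  - rewrite cos_plus.
    replace (r * (cos alpha * cos (2 * atan t) - sin alpha * sin (2 * atan t)))
      with (cos alpha * (r * cos (2 * atan t)) - sin alpha * (r * sin (2 * atan t))) by ring.
    rewrite Hsin, Hcos. unfold x, y.
    replace (cos alpha * (1 - s * sin alpha * cos alpha) - sin alpha * (s * sin alpha ^ 2))
      with (cos alpha - s * sin alpha * (sin alpha ^ 2 + cos alpha ^ 2)) by ring.
    rewrite Hp. ring.
Qed.

(** The cross product of two sheared vectors.  A common shear preserves area,
    which explains the first term; the second one is the relative shear. *)
Lemma kicked_angle_cross (alpha alpha' s s' : R) :
  kicked_radius alpha s * kicked_radius alpha' s' *
    sin (kicked_angle alpha' s' - kicked_angle alpha s) =
  sin (alpha' - alpha) + (s' - s) * sin alpha * sin alpha'.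
Proof.
  destruct (kicked_angle_polar alpha s) as [H1 H2].
  destruct (kicked_angle_polar alpha' s') as [H1' H2'].
  rewrite !sin_minus.
  set (r := kicked_radius alpha s) in *.
  set (r' := kicked_radius alpha' s') in *.
  set (k := kicked_angle alpha s) in *.
  set (k' := kicked_angle alpha' s') in *.
  replace (r * r' * (sin k' * cos k - cos k' * sin k))
    with ((r' * sin k') * (r * cos k) - (r' * cos k') * (r * sin k)) by ring.
  rewrite H1, H2, H1', H2'. ring.
Qed.

Lemma sin_nonpos_of_nonpos (x : R) : - PI <= x <= 0 -> sin x <= 0.
Proof.
  intros H. assert (Hx : 0 <= sin (- x)) by (apply sin_ge_0; lra).
  rewrite sin_neg in Hx. lra.
Qed.

(** Angles at distance less than [PI] keep their orientation under the
    area-preserving shear, and their difference stays above [- PI] because the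
    kicks lie in [[0, PI)], so the sign of its sine settles its sign.  At larger
    distance the bound on the kicks is enough. *)
Lemma kicked_angle_increasing (s alpha alpha' : R) :
  0 <= s -> alpha < alpha' -> kicked_angle alpha s < kicked_angle alpha' s.
Proof.
  intros Hs Ha.
  pose proof (phase_kick_bounds alpha s Hs) as B.
  pose proof (phase_kick_bounds alpha' s Hs) as B'.
  destruct (Rlt_le_dec (alpha' - alpha) PI) as [Hpi|Hpi];
    [|unfold kicked_angle; lra].
  pose proof (kicked_angle_cross alpha alpha' s s) as C.
  assert (0 < sin (alpha' - alpha)) by (apply sin_gt_0; lra).
  pose proof (kicked_radius_gt0 alpha s). pose proof (kicked_radius_gt0 alpha' s).
  apply Rnot_le_lt; intros Hle.
  assert (sin (kicked_angle alpha' s - kicked_angle alpha s) <= 0).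
  { apply sin_nonpos_of_nonpos; split; [|lra].
    unfold kicked_angle; lra. }
  assert (0 < kicked_radius alpha s * kicked_radius alpha' s) by nra.
  nra.
Qed.

(** For equal angles the cross product is [(s' - s) sin alpha ^ 2]. *)
Lemma kicked_angle_le_strength (alpha s s' : R) :
  0 <= s -> s < s' -> kicked_angle alpha s <= kicked_angle alpha s' /\
  (sin alpha <> 0 -> kicked_angle alpha s < kicked_angle alpha s').
Proof.
  intros Hs Hss.
  assert (Hs' : 0 <= s') by lra.
  pose proof (phase_kick_bounds alpha s Hs) as B.
  pose proof (phase_kick_bounds alpha s' Hs') as B'.
  pose proof (kicked_angle_polar alpha s) as [P _].
  pose proof (kicked_angle_cross alpha alpha s s') as C.
  rewrite Rminus_diag, sin_0, Rplus_0_l in C.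
  pose proof (kicked_radius_gt0 alpha s). pose proof (kicked_radius_gt0 alpha s').
  assert (Hrr : 0 < kicked_radius alpha s * kicked_radius alpha s') by nra.
  assert (strict : sin alpha <> 0 -> kicked_angle alpha s < kicked_angle alpha s').
  { intros Hsin. apply Rnot_le_lt; intros Hle.
    assert (sin (kicked_angle alpha s' - kicked_angle alpha s) <= 0).
    { apply sin_nonpos_of_nonpos; split; [|lra]. unfold kicked_angle; lra. }
    pose proof (pow2_gt_0 _ Hsin).
    assert (0 < (s' - s) * sin alpha * sin alpha)
      by (rewrite Rmult_assoc; apply Rmult_lt_0_compat; nra).
    nra. }
  split; [|exact strict].
  destruct (Req_dec (sin alpha) 0) as [Hsin0|Hsin0]; [|left; auto].
  unfold kicked_angle. rewrite !phase_kick_node by exact Hsin0. lra.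
Qed.

(** * The final angle as a function of the spectral parameter *)

Definition end_phase (l b1 M lambda : R) : R :=
  kicked_angle (lambda * b1) (M * lambda) + lambda * (l - b1).

Lemma end_phase_continuity (l b1 M : R) : continuity (end_phase l b1 M).
Proof.
  intros x. apply derivable_continuous_pt, ex_derive_Reals_0.
  unfold end_phase, kicked_angle, phase_kick, kicked_radius.
  auto_derive.
  pose proof (kicked_vector_neq0 (x * b1) (M * x)) as H.
  pose proof (phase_kick_denominator_gt0 (x * b1) (M * x)) as H'.
  unfold kicked_radius in H'. simpl in *.
  repeat split; try exact H.
  apply Rgt_not_eq, H'.
Qed.

Lemma end_phase_increasing (l b1 M x x' : R) :
  0 < l -> 0 <= b1 <= l -> 0 <= M -> 0 <= x -> x < x' ->
  end_phase l b1 M x < end_phase l b1 M x'.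
Proof.
  intros Hl Hb HM Hx Hxx. unfold end_phase.
  assert (strength : kicked_angle (x * b1) (M * x) <= kicked_angle (x * b1) (M * x')).
  { destruct HM as [HM|<-]; [|rewrite !Rmult_0_l; lra].
    apply kicked_angle_le_strength; nra. }
  assert (Hs' : 0 <= M * x') by nra.
  destruct (Req_dec b1 0) as [->|H0].
  - (* A load at the end [0] never kicks; the growth comes from [lambda l]. *)
    rewrite !Rmult_0_r in *.
    enough (kicked_angle 0 (M * x) = kicked_angle 0 (M * x')) by nra.
    unfold kicked_angle. now rewrite !phase_kick_node by exact sin_0.
  - (* Here [l - b1] may vanish, so strictness comes from the kicked angle. *)
    pose proof (kicked_angle_increasing (M * x') (x * b1) (x' * b1) Hs').
    nra.
Qed.

Lemma end_phase_0 (l b1 M : R) : end_phase l b1 M 0 = 0.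
Proof.
  unfold end_phase, kicked_angle, phase_kick.
  rewrite !Rmult_0_l, Rmult_0_r. unfold Rdiv. rewrite !Rmult_0_l, atan_0. ring.
Qed.

Lemma end_phase_ge (l b1 M x : R) :
  0 <= M -> 0 <= x -> x * l <= end_phase l b1 M x.
Proof.
  intros HM Hx. unfold end_phase, kicked_angle.
  assert (Hs : 0 <= M * x) by nra.
  pose proof (phase_kick_bounds (x * b1) (M * x) Hs). lra.
Qed.

Lemma end_phase_char (l b1 M x : R) :
  kicked_radius (x * b1) (M * x) * sin (end_phase l b1 M x) =
  sin (x * l) - M * x * sin (x * b1) * sin (x * (l - b1)).
Proof.
  destruct (kicked_angle_polar (x * b1) (M * x)) as [H1 H2].
  unfold end_phase. rewrite sin_plus.
  replace (x * l) with (x * b1 + x * (l - b1)) by ring. rewrite sin_plus.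
  set (r := kicked_radius _ _) in *. set (k := kicked_angle _ _) in *.
  replace (r * (sin k * cos (x * (l - b1)) + cos k * sin (x * (l - b1))))
    with ((r * sin k) * cos (x * (l - b1)) + (r * cos k) * sin (x * (l - b1))) by ring.
  rewrite H1, H2. ring.
Qed.

(** * Eigenvalues as levels of the final angle *)

Definition load_strength (rho T m1 v : R) : R :=
  m1 / rho * (wave_speed rho T ^ 2 + v ^ 2).

Lemma load_strength_ge0 (rho T m1 v : R) :
  0 < rho -> 0 < m1 -> 0 <= load_strength rho T m1 v.
Proof.
  intros Hrho Hm. apply Rmult_le_pos.
  - left; now apply Rdiv_lt_0_compat.
  - pose proof (pow2_ge_0 (wave_speed rho T)). pose proof (pow2_ge_0 v). lra.
Qed.

Lemma load_strength_increasing (rho T m1 v v' : R) :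
  0 < rho -> 0 < m1 -> 0 <= v -> v < v' ->
  load_strength rho T m1 v < load_strength rho T m1 v'.
Proof.
  intros Hrho Hm Hv Hvv. apply Rmult_lt_compat_l.
  - now apply Rdiv_lt_0_compat.
  - nra.
Qed.

Lemma is_eigenvalue_phase (l rho T m1 b1 v x : R) :
  is_eigenvalue l rho T m1 b1 v x <->
  0 < x /\ sin (end_phase l b1 (load_strength rho T m1 v) x) = 0.
Proof.
  pose proof (end_phase_char l b1 (load_strength rho T m1 v) x) as E.
  pose proof (kicked_radius_gt0 (x * b1) (load_strength rho T m1 v * x)) as Hr.
  set (S := sin (end_phase _ _ _ _)) in *. set (r := kicked_radius _ _) in *.
  assert (EC : 0 < x -> r * S = x * char_lhs l rho T m1 b1 v x).
  { intros Hx. rewrite E. unfold char_lhs, load_strength; cbv zeta.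
    generalize (m1 / rho); intros c. field; lra. }
  split; intros [Hx H]; split; auto; specialize (EC Hx).
  - rewrite H, Rmult_0_r in EC. apply Rmult_integral in EC. lra.
  - rewrite H, Rmult_0_r in EC. symmetry in EC. apply Rmult_integral in EC. lra.
Qed.

(** By strong induction: [g k] is some [f j], where [j < k] would make it equal
    to the earlier [g j]; hence [f k <= g k], and conversely. *)
Lemma increasing_enumeration_unique (f g : nat -> R) :
  (forall j k : nat, (1 <= j)%nat -> (j < k)%nat -> f j < f k) ->
  (forall j k : nat, (1 <= j)%nat -> (j < k)%nat -> g j < g k) ->
  (forall x : R, (exists k : nat, (1 <= k)%nat /\ x = f k) <->
                 (exists k : nat, (1 <= k)%nat /\ x = g k)) ->
  forall k : nat, (1 <= k)%nat -> f k = g k.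
Proof.
  intros Hf Hg Hfg k. induction k as [k IH] using lt_wf_ind. intros Hk.
  destruct (proj2 (Hfg (g k))) as [j [Hj Ej]]; [now exists k|].
  destruct (proj1 (Hfg (f k))) as [i [Hi Ei]]; [now exists k|].
  assert (k <= j)%nat.
  { apply Nat.nlt_ge; intros Hlt. pose proof (IH j Hlt Hj). pose proof (Hg j k Hj Hlt). lra. }
  assert (k <= i)%nat.
  { apply Nat.nlt_ge; intros Hlt. pose proof (IH i Hlt Hi). pose proof (Hf i k Hi Hlt). lra. }
  assert (f k <= f j).
  { destruct (Nat.eq_dec k j) as [->|]; [lra|]. left; apply Hf; lia. }
  assert (g k <= g i).
  { destruct (Nat.eq_dec k i) as [->|]; [lra|]. left; apply Hg; lia. }
  lra.
Qed.

(** The final angle grows from [0] and dominates [lambda l], so it takes each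
    value [k PI] exactly once, no later than at [k PI / l]. *)
Lemma eigenvalue_sequence_of_phase (l rho T m1 b1 v : R) :
  0 < l -> 0 < rho -> 0 < m1 -> 0 <= b1 <= l ->
  exists mu : nat -> R, eigenvalue_sequence l rho T m1 b1 v mu /\
    forall k : nat, (1 <= k)%nat ->
      0 < mu k /\ end_phase l b1 (load_strength rho T m1 v) (mu k) = INR k * PI.
Proof.
  intros Hl Hrho Hm Hb.
  set (M := load_strength rho T m1 v).
  assert (HM : 0 <= M) by now apply load_strength_ge0.
  pose proof PI_RGT_0 as Hpi.
  assert (solve : forall k : nat, {x : R | 0 <= x /\ end_phase l b1 M x = INR k * PI}).
  { intros k.
    assert (H0 : 0 <= INR k * PI) by (apply Rmult_le_pos; [apply pos_INR|lra]).
    assert (Hx : 0 <= INR k * PI / l)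
      by (apply Rmult_le_pos; [easy|left; now apply Rinv_0_lt_compat]).
    destruct (IVT_cor (fun x => end_phase l b1 M x - INR k * PI) 0 (INR k * PI / l))
      as [z [Hz Ez]]; auto.
    - apply continuity_minus; [apply end_phase_continuity|].
      apply continuity_const; now intros x y.
    - rewrite end_phase_0.
      pose proof (end_phase_ge l b1 M (INR k * PI / l) HM Hx) as H.
      replace (INR k * PI / l * l) with (INR k * PI) in H by (field; lra).
      nra.
    - exists z. split; lra. }
  exists (fun k => proj1_sig (solve k)).
  assert (spec : forall k : nat, (1 <= k)%nat ->
    0 < proj1_sig (solve k) /\ end_phase l b1 M (proj1_sig (solve k)) = INR k * PI).
  { intros k Hk. destruct (solve k) as [x [[Hx|<-] E]]; simpl; [easy|].
    rewrite end_phase_0 in E. apply (lt_INR 0 k) in Hk. simpl in Hk. nra. }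
  split; [|exact spec]. split.
  - intros j k Hj Hjk.
    destruct (spec j Hj) as [Pj Ej], (spec k) as [Pk Ek]; [lia|].
    apply Rnot_le_lt; intros Hle.
    apply lt_INR in Hjk.
    destruct Hle as [Hlt|Heq]; [|rewrite Heq in Ek; nra].
    pose proof (end_phase_increasing l b1 M _ _ Hl Hb HM (Rlt_le _ _ Pk) Hlt). nra.
  - intros x. rewrite is_eigenvalue_phase. fold M. split.
    + intros [Hx Hs].
      destruct (sin_eq_0_0 _ Hs) as [z Hz].
      assert (Hpos : 0 < IZR z).
      { pose proof (end_phase_ge l b1 M x HM (Rlt_le _ _ Hx)). nra. }
      apply lt_IZR in Hpos.
      exists (Z.to_nat z).
      assert (Hk : (1 <= Z.to_nat z)%nat) by lia.
      split; [exact Hk|].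
      destruct (spec _ Hk) as [Pk Ek].
      assert (Ez : IZR z = INR (Z.to_nat z))
        by (rewrite INR_IZR_INZ, Z2Nat.id; [easy|lia]).
      rewrite Ez, <- Ek in Hz.
      destruct (Rtotal_order x (proj1_sig (solve (Z.to_nat z)))) as [H|[H|H]]; [|exact H|].
      * pose proof (end_phase_increasing l b1 M _ _ Hl Hb HM (Rlt_le _ _ Hx) H). lra.
      * pose proof (end_phase_increasing l b1 M _ _ Hl Hb HM (Rlt_le _ _ Pk) H). lra.
    + intros [k [Hk ->]]. destruct (spec k Hk) as [Pk Ek]. split; [exact Pk|].
      rewrite Ek. apply sin_eq_0_1. exists (Z.of_nat k). now rewrite INR_IZR_INZ.
Qed.

Lemma end_phase_eigenvalue (l rho T m1 b1 v : R) (lam : nat -> R) :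
  0 < l -> 0 < rho -> 0 < m1 -> 0 <= b1 <= l ->
  eigenvalue_sequence l rho T m1 b1 v lam ->
  forall k : nat, (1 <= k)%nat ->
    0 < lam k /\ end_phase l b1 (load_strength rho T m1 v) (lam k) = INR k * PI.
Proof.
  intros Hl Hrho Hm Hb [Hinc Hlam] k Hk.
  destruct (eigenvalue_sequence_of_phase l rho T m1 b1 v Hl Hrho Hm Hb)
    as [mu [[Hmuinc Hmu] spec]].
  rewrite (increasing_enumeration_unique lam mu Hinc Hmuinc); auto.
  intros x. rewrite <- Hlam, <- Hmu. reflexivity.
Qed.

(** When [sin (x b1)] vanishes the equation reduces to [sin (x l) = 0], which
    is [cos (x b1) sin (x (l - b1)) = 0] with [cos (x b1)] nonzero. *)
Lemma node_of_eigenvalue (l rho T m1 b1 v x : R) :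
  is_eigenvalue l rho T m1 b1 v x -> sin (x * b1) = 0 -> load_at_node l b1 x.
Proof.
  intros H H0. split; [exact H0|].
  apply is_eigenvalue_phase in H. destruct H as [Hx Hs].
  pose proof (end_phase_char l b1 (load_strength rho T m1 v) x) as E.
  rewrite Hs, H0 in E.
  replace (x * l) with (x * b1 + x * (l - b1)) in E by ring.
  rewrite sin_plus, H0 in E.
  pose proof (sin2_add_cos2 (x * b1)) as P. rewrite H0 in P.
  assert (Ec : cos (x * b1) * sin (x * (l - b1)) = 0) by lra.
  apply Rmult_integral in Ec. destruct Ec as [Ec|Ec]; [|exact Ec].
  rewrite Ec in P. lra.
Qed.

Theorem proposition1 :
  forall l rho T m1 b1 : R,
    0 < l -> 0 < rho -> 0 < T -> 0 < m1 -> 0 <= b1 <= l ->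
    (forall v : R, 0 <= v ->
       exists lam : nat -> R, eigenvalue_sequence l rho T m1 b1 v lam) /\
    (forall (v v' : R) (lam lam' : nat -> R),
       0 <= v -> v < v' ->
       eigenvalue_sequence l rho T m1 b1 v lam ->
       eigenvalue_sequence l rho T m1 b1 v' lam' ->
       forall k : nat, (1 <= k)%nat ->
         lam' k <= lam k /\
         natural_frequency rho T lam' k <= natural_frequency rho T lam k /\
         (~ load_at_node l b1 (lam k) ->
            lam' k < lam k /\
            natural_frequency rho T lam' k < natural_frequency rho T lam k)).
Proof.
  intros l rho T m1 b1 Hl Hrho HT Hm Hb. split.
  - intros v _.
    destruct (eigenvalue_sequence_of_phase l rho T m1 b1 v Hl Hrho Hm Hb) as [mu [H _]].
    now exists mu.
  - intros v v' lam lam' Hv Hvv Hlam Hlam' k Hk.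
    destruct (end_phase_eigenvalue _ _ _ _ _ _ _ Hl Hrho Hm Hb Hlam k Hk) as [P E].
    destruct (end_phase_eigenvalue _ _ _ _ _ _ _ Hl Hrho Hm Hb Hlam' k Hk) as [P' E'].
    pose proof (load_strength_ge0 rho T m1 v Hrho Hm) as HM.
    pose proof (load_strength_ge0 rho T m1 v' Hrho Hm) as HM'.
    pose proof (load_strength_increasing rho T m1 v v' Hrho Hm Hv Hvv) as HMM.
    set (M := load_strength rho T m1 v) in *.
    set (M' := load_strength rho T m1 v') in *.
    assert (Ha : 0 < wave_speed rho T)
      by (apply sqrt_lt_R0; now apply Rdiv_lt_0_compat).
    destruct (kicked_angle_le_strength (lam k * b1) (M * lam k) (M' * lam k))
      as [Kle Klt]; [nra|nra|].
    assert (le : lam' k <= lam k).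
    { apply Rnot_lt_le; intros Hlt.
      pose proof (end_phase_increasing l b1 M' _ _ Hl Hb HM' (Rlt_le _ _ P) Hlt) as I.
      unfold end_phase in E, E', I. lra. }
    split; [exact le|]. split; [now apply Rmult_le_compat_l; [lra|]|].
    intros Hnode.
    assert (lt : lam' k < lam k).
    { destruct le as [lt|Eq]; [exact lt|exfalso].
      assert (Hsin : sin (lam k * b1) <> 0).
      { intros H0. apply Hnode, (node_of_eigenvalue l rho T m1 b1 v); [|exact H0].
        apply (proj2 Hlam). now exists k. }
      specialize (Klt Hsin). rewrite Eq in E'.
      unfold end_phase in E, E'. lra. }
    split; [exact lt|now apply Rmult_lt_compat_l].
Qed.
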